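(* Let $q$ be a prime power, $n\ge0$ and $k\ge1$ integers. Let $P_{A,n}(k,q)$ be the probability that a uniformly random $\alpha\in A(n,q)$ has fixed space $\{v\in\mathbb{F}_q^{n+1}:\alpha v=v\}$ of dimension $k$, and $P_{A,\infty}(k,q)=\lim_{n\to\infty}P_{A,n}(k,q)$. Then (1) \[ P_{A,n}(k,q)=\frac{1}{|A(k-1,q)|}\sum_{i=0}^{n-k+1}\frac{(-1)^i}{q^{ki}(q^i-1)\cdots(q-1)}; \] (2) \[ P_{A,\infty}(k,q)=\Bigl[\prod_{r=1}^\infty(1-q^{-r})\Bigr]\frac{(1/q)^{k^2-k}}{(1-1/q)^2\cdots(1-1/q^{k-1})^2(1-1/q^k)}. \]
   Context: $A(n,q)$ is the group of matrices $x\in GL(n+1,q)$ with $x_{11}=1$ and $x_{j1}=0$ for $j\ge2$, acting on $\mathbb{F}_q^{n+1}$; $|A(m,q)|=q^m|GL(m,q)|$. An empty sum is $0$ and the $i=0$ term equals $1$. *)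

(* Defs.v *)
From HB Require Import structures.
From mathcomp Require Import all_boot all_order all_algebra all_field.
From mathcomp Require Import all_classical all_reals all_analysis.
Set Implicit Arguments. Unset Strict Implicit. Unset Printing Implicit Defensive.
Import Order.TTheory GRing.Theory Num.Theory.
Local Open Scope ring_scope.

Definition Aset (F : finFieldType) (n : nat) : {set 'M[F]_(n.+1)} :=
  [set x : 'M[F]_(n.+1) | [&& x \in unitmx, x ord0 ord0 == 1 &
      [forall j : 'I_n.+1, (j != ord0) ==> (x j ord0 == 0)]]].

(* Dimension of the fixed space {v in F^(n+1) : x v = v} (column vectors v).
   kermx (x^T - 1) has as row space {u : u *m (x^T - 1) = 0}
   = {u : x *m u^T = u^T}, i.e. the transposes of the fixed vectors. *)
Definition fixdim (F : finFieldType) (n : nat) (x : 'M[F]_(n.+1)) : nat :=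
  \rank (kermx (x^T - 1%:M)).

Definition PA (R : realType) (F : finFieldType) (n k : nat) : R :=
  (#|[set x in Aset F n | fixdim x == k]|)%:R / (#|Aset F n|)%:R.

(* Main.v *)
(* Transposing, elements of A(n,q) are the invertible matrices fixing the row
   vector e = delta_mx 0 0.  A(n,q) is transitive on the independent families of
   the form (e, v_1, ..., v_j), j <= n, so by Burnside's counting a random element
   fixes one such family on average; if the fixed space has dimension d, it fixes
   (q^d - q)...(q^d - q^j) of them.  These averages, all equal to 1, determine the
   law of d by Newton interpolation at the points q^d, which gives (1).  For (2),
   the series f_k of (1) satisfies f_k = (1 - q^-(k+1)) f_(k+1) and f_k -> 1, hence
   f_k = prod_(r > k) (1 - q^-r). *)
Require Import Defs.
From HB Require Import structures.
From mathcomp Require Import all_boot all_order all_algebra all_field.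
From mathcomp Require Import mxabelem zify ring lra.
From mathcomp Require Import all_classical all_reals all_analysis.
Import Order.TTheory GRing.Theory Num.Theory.
Import numFieldNormedType.Exports.
Local Open Scope ring_scope.

(** * Counting independent families over a finite field *)

Definition frames (F : finFieldType) (j a b N : nat) (U : 'M[F]_(a, N))
    (K : 'M[F]_(b, N)) : {set 'M[F]_(j, N)} :=
  [set V : 'M[F]_(j, N) | row_free (col_mx U V) && (V <= K)%MS]%SET.

Lemma row_free_col_mx_row (F : fieldType) (a N : nat) (U : 'M[F]_(a, N))
    (w : 'rV[F]_N) :
  row_free U -> row_free (col_mx U w) = ~~ (w <= U)%MS.
Proof.
move=> /eqP rU; rewrite /row_free -addsmxE.
have [wU|wU] /= := boolP (w <= U)%MS.
  apply/negbTE; rewrite (addsmx_idPl wU) rU.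
  by rewrite neq_ltn addn1 ltnSn.
rewrite eqn_leq addsmxE rank_leq_row /= -addsmxE -{1}rU addn1.
by rewrite ltn_neqAle mxrankS ?addsmxSl // andbT mxrank_leqif_eq ?addsmxSl //
  addsmx_sub submx_refl wU.
Qed.

Lemma row_free_col_mxA (F : fieldType) (a b c N : nat) (U : 'M[F]_(a, N))
    (V : 'M[F]_(b, N)) (W : 'M[F]_(c, N)) :
  row_free (col_mx U (col_mx V W)) = row_free (col_mx (col_mx U V) W).
Proof. by rewrite col_mxA row_free_castmx. Qed.

Lemma row_free_col_mxl (F : fieldType) (a b N : nat) (U : 'M[F]_(a, N))
    (V : 'M[F]_(b, N)) : row_free (col_mx U V) -> row_free U.
Proof.
rewrite /row_free -addsmxE => /eqP rUV; rewrite eqn_leq rank_leq_row /=.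
have [+ _] := mxrank_adds_leqif U V; rewrite rUV.
by move=> /leq_trans/(_ (leq_add (leqnn _) (rank_leq_row V))); rewrite leq_add2r.
Qed.

(** Rows are chosen one at a time, each in [K] but outside the span of the previous ones. The
    differences are taken in a ring: when the rank of [K] is too small, a zero factor keeps the
    formula valid. *)
Lemma card_frames (F : finFieldType) (R : pzRingType) (j a b N : nat)
    (U : 'M[F]_(a, N)) (K : 'M[F]_(b, N)) :
  row_free U -> (U <= K)%MS ->
  #|frames F j a b N U K|%:R =
    \prod_(i < j) ((#|F| ^ \rank K)%:R - (#|F| ^ (a + i))%:R) :> R.
Proof.
elim: j a U => [|j IHj] a U Ufree UK.
  rewrite big_ord0 (_ : frames _ _ _ _ _ _ _ = [set: 'M[F]_(0, N)]%SET).
    by rewrite cardsT card_mx mul0n.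
  apply/setP => V; rewrite !inE (flatmx0 V) sub0mx andbT.
  by move: Ufree; rewrite /row_free -addsmxE addsmx0 addn0.
rewrite -sum1_card natr_sum.
rewrite (reindex (fun p : 'rV[F]_N * 'M[F]_(j, N) => col_mx p.1 p.2)) /=; last first.
  exists (fun V : 'M[F]_(1 + j, N) => (usubmx V, dsubmx V)) => [[w V]|V] _ /=.
    by rewrite col_mxKu col_mxKd.
  by rewrite vsubmxK.
rewrite (eq_bigl (fun p : 'rV[F]_N * 'M[F]_(j, N) =>
  (p.1 \in rowg K :\: rowg U)%SET && (p.2 \in frames F j _ _ N (col_mx U p.1) K)));
  last first.
  move=> [w V] /=; rewrite !inE.
  rewrite (_ : row_free _ = row_free (col_mx (col_mx U w) V)); last first.
    exact: (row_free_col_mxA F a 1 j N).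
  rewrite (_ : (col_mx w V <= K)%MS = (w <= K)%MS && (V <= K)%MS); last first.
    by rewrite -addsmx_sub addsmxE.
  case: (boolP (row_free (col_mx (col_mx U w) V))) => [fUwV|]; last by rewrite andbF.
  by rewrite -row_free_col_mx_row // (row_free_col_mxl _ _ _ _ _ _ fUwV).
rewrite -(pair_big_dep (fun w => w \in rowg K :\: rowg U)%SET
  (fun w V => V \in frames F j _ _ N (col_mx U w) K) (fun _ _ => 1%:R)) /=.
rewrite (eq_bigr (fun=> \prod_(i < j) ((#|F| ^ \rank K)%:R - (#|F| ^ (a + i.+1))%:R)));
  last first.
  move=> w; rewrite !inE => /andP[wU wK].
  rewrite -natr_sum sum1_card IHj.
  - by apply: eq_bigr => i _; rewrite addn1 addSnnS.
  - by rewrite row_free_col_mx_row.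
  - by rewrite -addsmxE addsmx_sub UK.
rewrite sumr_const big_ord_recl addn0 -[LHS]mulr_natl; congr (_ * _).
rewrite cardsD (finset.setIidPr _); last first.
  by apply/fintype.subsetP => w; rewrite !inE => /submx_trans; apply.
by rewrite !card_rowg (eqP Ufree) natrB // leq_exp2l ?card_finNzRing_gt1 // -(eqP Ufree) mxrankS.
Qed.

(** * The group A(n,q) and its action on frames *)

Lemma in_Aset (F : finFieldType) (n : nat) (x : 'M[F]_n.+1) :
  (x \in Aset F n) =
  (x \in unitmx) && (delta_mx 0 0 *m x^T == delta_mx 0 0 :> 'rV[F]_n.+1).
Proof.
rewrite inE; congr (_ && _); apply/andP/eqP => [[/eqP x00 /forallP xj0]|ex].
  rewrite -rowE; apply/rowP => j; rewrite !mxE eqxx /=.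
  by have [->|j0] := eqVneq j 0; [rewrite x00|rewrite (eqP (implyP (xj0 j) j0))].
have xE j : x j 0 = (j == 0)%:R.
  by move/rowP/(_ j): ex; rewrite -rowE !mxE eqxx.
split; first by rewrite (xE 0).
by apply/forallP => j; apply/implyP => /negbTE j0; rewrite (xE j) j0.
Qed.

Lemma row_free_delta (F : fieldType) (n : nat) :
  row_free (delta_mx 0 0 : 'rV[F]_n.+1).
Proof. by rewrite /row_free mxrank_delta. Qed.

(** The first row of [x^T] is [delta_mx 0 0], so [x^T] amounts to its other [n] rows, a frame in the
    whole space. *)
Lemma card_Aset (F : finFieldType) (R : pzRingType) (n : nat) :
  #|Aset F n|%:R = \prod_(i < n) ((#|F| ^ n.+1)%:R - (#|F| ^ i.+1)%:R) :> R.
Proof.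
have := card_frames F R n _ _ _ _ _ (row_free_delta F n) (submx1 _).
rewrite mxrank1 => <-; congr (_%:R).
set f := fun V : 'M[F]_(n, n.+1) => (col_mx (delta_mx 0 0 : 'rV_n.+1) V)^T : 'M[F]_n.+1.
rewrite -(card_in_imset (f := f)) => [|V W _ _ /trmx_inj E]; last by have [] := @eq_col_mx _ 1 n _ _ _ _ _ E.
apply: eq_card => x; apply/idP/imsetP => [|[V VK ->]].
  rewrite in_Aset => /andP[xu /eqP ex].
  have xE : x^T = col_mx (delta_mx 0 0 : 'rV_n.+1) (@dsubmx _ 1 n _ x^T).
    apply: etrans (esym (@vsubmxK _ 1 n _ x^T)) _; congr col_mx.
    rewrite -ex -rowE; apply/rowP => j; rewrite !mxE; congr (x _ _).
    exact/val_inj.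
  exists (@dsubmx _ 1 n _ x^T); last by rewrite /f -xE trmxK.
  by rewrite inE submx1 andbT -xE row_free_unit unitmx_tr.
rewrite in_Aset unitmx_tr trmxK -row_free_unit.
move: VK; rewrite inE => /andP[-> _] /=; apply/eqP/rowP => j.
rewrite -rowE [LHS]mxE; set e : 'rV[F]_n.+1 := delta_mx 0 0.
by rewrite -(@col_mxEu _ 1 n _ e V); congr (col_mx e V _ j); apply: val_inj.
Qed.

(* Burnside's count: Aset acts transitively on the frames extending the fixed
   vector [delta_mx 0 0], so a random element fixes one of them on average. *)
Lemma sum_card_fixed_frames (F : finFieldType) (n j : nat) : (j <= n)%N ->
  (\sum_(x in Aset F n)
    #|frames F j 1 n.+1 n.+1 (delta_mx 0 0)%R (kermx (x^T - 1%:M)%R)|)%N =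
  #|Aset F n|.
Proof.
move=> jn; set e : 'rV[F]_n.+1 := delta_mx 0 0.
(* The rows of [I] are the first [1 + j] standard basis vectors; [V0], all but the first, is the
   reference frame. *)
pose I : 'M[F]_(1 + j, n.+1) := pid_mx (1 + j).
have I_id : I *m (pid_mx (1 + j) : 'M[F]_(n.+1, 1 + j)) = 1%:M.
  by rewrite pid_mx_id // pid_mx_1.
have rI : row_free I by apply/row_freeP; exists (pid_mx (1 + j)).
pose V0 := dsubmx I.
have IE : I = col_mx e V0.
  rewrite -[LHS]vsubmxK; congr col_mx; apply/rowP => i.
  by rewrite !mxE eqxx /= andbT eq_sym.
have fixE (x : 'M[F]_n.+1) (V : 'M[F]_(j, n.+1)) :
    (V <= kermx (x^T - 1%:M))%MS = (V *m x^T == V).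
  by rewrite -subr_eq0 -{3}[V]mulmx1 -mulmxBr; apply/sub_kermxP/eqP.
(* The stabilizer of [V] is a translate of the set of elements sending [V0] to [V]: if [g] fixes [e]
   and takes [V0] to [V], then [x] fixes [V] iff [x *m g^T] sends [V0] to [V]. *)
have stabE (V : 'M[F]_(j, n.+1)) : row_free (col_mx e V) ->
    (\sum_(x in Aset F n) (V *m x^T == V))%N =
    (\sum_(x in Aset F n) (V0 *m x^T == V))%N.
  move=> Vfree.
  have [|g gu] := @complete_unitmx _ _ _ I (pid_mx (1 + j) *m col_mx e V).
    by rewrite mulmxA I_id mul1mx (eqP rI) (eqP Vfree).
  rewrite mulmxA I_id mul1mx IE mul_col_mx => /eq_col_mx[eg Vg].
  rewrite [RHS](reindex (fun x : 'M[F]_n.+1 => x *m g^T)) /=; last first.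
    exists (fun x : 'M[F]_n.+1 => x *m invmx g^T) => x _.
      by rewrite mulmxK // unitmx_tr.
    by rewrite mulmxKV // unitmx_tr.
  apply: eq_big => [x|x _]; last by rewrite trmx_mul trmxK mulmxA -Vg.
  by rewrite !in_Aset unitmx_mul unitmx_tr gu andbT trmx_mul trmxK mulmxA -eg.
transitivity (\sum_(x in Aset F n)
    \sum_(V : 'M[F]_(j, n.+1) | row_free (col_mx e V)) (V *m x^T == V))%N.
  apply: eq_bigr => x _; rewrite -sum1_card [RHS]big_mkcond /= big_mkcond /=.
  apply: eq_bigr => V _; rewrite inE fixE.
  by case: row_free; case: eqP.
rewrite exchange_big /= (eq_bigr _ stabE) exchange_big /= -sum1_card.
(* Each [x] sends [V0] to exactly one frame, so every [x] contributes 1. *)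
apply: eq_bigr => x; rewrite in_Aset => /andP[xu /eqP].
rewrite -/e => ex; rewrite (bigD1 (V0 *m x^T)) /=; last first.
  by rewrite -{1}ex -mul_col_mx -IE /row_free mxrankMfree ?(eqP rI) // row_free_unit
    unitmx_tr.
by rewrite eqxx big1 // => V /andP[_ /negbTE]; rewrite eq_sym => ->.
Qed.

(** * Alternating q-binomial sums and interpolation *)

Lemma qpow_sub1_neq0 (R : realFieldType) (q : R) (l : nat) : 1 < q -> q ^+ l.+1 - 1 != 0.
Proof. by move=> q1; rewrite gt_eqF // subr_gt0 exprn_egt1. Qed.

(** The q-analogue of sum_(i <= m) (-1)^i C(x,i) = (-1)^m C(x-1,m), with [Q] in the role of
    [q ^+ x]. *)
Lemma sum_qfalling_telescope (R : realFieldType) (q Q : R) (m : nat) : 1 < q ->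
  \sum_(i < m.+1) (-1) ^+ i * \prod_(l < i) ((Q - q ^+ l) / (q ^+ l.+1 - 1)) =
  (-1) ^+ m * \prod_(l < m) ((Q - q ^+ l.+1) / (q ^+ l.+1 - 1)).
Proof.
move=> q1; elim: m => [|m IHm]; first by rewrite big_ord1 !big_ord0.
rewrite big_ord_recr /= IHm.
have -> : \prod_(l < m.+1) ((Q - q ^+ l) / (q ^+ l.+1 - 1)) =
    (\prod_(l < m) ((Q - q ^+ l.+1) / (q ^+ l.+1 - 1))) * ((Q - 1) / (q ^+ m.+1 - 1)).
  rewrite !big_split /= [X in X * _]big_ord_recl /= [X in _ * X = _]big_ord_recr /=.
  by rewrite expr0; ring.
rewrite [in RHS]big_ord_recr /= exprS.
by field; exact: qpow_sub1_neq0.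
Qed.

(** After telescoping, the factor [l = a - 1] vanishes if [a] is positive, and all factors are -1 if
    [a] is 0. *)
Lemma sum_qfalling_delta (R : realFieldType) (q : R) (a m : nat) : 1 < q -> (a <= m)%N ->
  \sum_(i < m.+1) (-1) ^+ i * \prod_(l < i) ((q ^+ a - q ^+ l) / (q ^+ l.+1 - 1)) =
  (a == 0)%:R.
Proof.
move=> q1 am; rewrite sum_qfalling_telescope //.
case: a am => [|a] am /=; last first.
  by rewrite (bigD1 (Ordinal am)) //= subrr !mul0r mulr0.
rewrite (eq_bigr (fun=> -1)) => [|l _]; last first.
  by rewrite -opprB mulNr divff // qpow_sub1_neq0.
by rewrite prodr_const card_ord -exprMn mulrNN mulr1 expr1n.
Qed.

(* Newton interpolation at the nodes [q ^+ d]: the delta function at [k.+1] is a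
   combination of the polynomials whose averages are [sum_card_fixed_frames]. *)
Lemma qfalling_interpolation (R : realFieldType) (q : R) (n k d : nat) :
    1 < q -> (0 < d <= n.+1)%N ->
  \sum_(0 <= i < n.+1 - k)
     (-1) ^+ i / (q ^+ (k.+1 * i) * \prod_(1 <= j < i.+1) (q ^+ j - 1)) *
     \prod_(l < k + i) (q ^+ d - q ^+ l.+1) =
  (d == k.+1)%:R * \prod_(l < k) (q ^+ k.+1 - q ^+ l.+1).
Proof.
move=> q1 /andP[d0 dn]; have q0 : q != 0 by rewrite gt_eqF // (lt_trans ltr01).
have [dk|kd] := ltnP d k.+1.
  (* For [d <= k] every term contains the zero factor [l = d - 1]. *)
  rewrite ltn_eqF // mul0r big1 // => i _.
  have dki : (d.-1 < k + i)%N by rewrite prednK // (leq_trans _ (leq_addr _ _)).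
  by rewrite (bigD1 (Ordinal dki)) //= prednK // subrr mul0r mulr0.
have kn : (k <= n)%N by rewrite -ltnS (leq_trans kd).
rewrite subSn // big_mkord.
(* The factors with [l < k] come out. Each later one is [q ^+ k.+1] times a factor for the node
   [q ^+ (d - k.+1)], and these powers cancel the one in the denominator. *)
transitivity (\prod_(l < k) (q ^+ d - q ^+ l.+1) *
  \sum_(i < (n - k).+1) (-1) ^+ i *
    \prod_(l < i) ((q ^+ (d - k.+1) - q ^+ l) / (q ^+ l.+1 - 1))).
  rewrite mulr_sumr; apply: eq_bigr => i _.
  rewrite big_split_ord /= mulrCA; congr (_ * _).
  rewrite -mulrA; congr (_ * _).
  rewrite (eq_bigr (fun l : 'I_i => q ^+ k.+1 * (q ^+ (d - k.+1) - q ^+ l))) => [|l _].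
    rewrite !big_split /= prodr_const card_ord -exprM prodfV.
    rewrite big_add1 /= big_mkord.
    rewrite invfM mulrACA mulVf ?expf_neq0 // mul1r mulrC; congr (_ * _^-1).
  by rewrite mulrBr -!exprD subnKC // addSn.
rewrite sum_qfalling_delta //; last by rewrite -(subSS k n) leq_sub2r.
rewrite subn_eq0 mulrC eqn_leq kd andbT.
by have [dk|] := leqP d k.+1; rewrite ?mul0r // (_ : d = k.+1) //; apply/eqP; rewrite eqn_leq dk.
Qed.

(** * The law of the fixed-space dimension *)

Lemma fixdim_bounds (F : finFieldType) (n : nat) (x : 'M[F]_n.+1) :
  x \in Aset F n -> (0 < fixdim x <= n.+1)%N.
Proof.
rewrite in_Aset => /andP[_ /eqP ex]; rewrite rank_leq_row andbT.
apply: leq_trans (mxrankS (A := (delta_mx 0 0 : 'rV[F]_n.+1)) _).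
  by rewrite mxrank_delta.
by apply/sub_kermxP; rewrite mulmxBr mulmx1 ex subrr.
Qed.

(** The product counts the frames over [delta_mx 0 0] inside the fixed space; exponents start at 1
    because that vector is already chosen. *)
Lemma mean_qfalling_fixdim (F : finFieldType) (R : pzRingType) (n j : nat) : (j <= n)%N ->
  \sum_(x in Aset F n)
    \prod_(l < j) ((#|F|)%:R ^+ fixdim x - (#|F|)%:R ^+ l.+1) =
  #|Aset F n|%:R :> R.
Proof.
move=> jn; rewrite -(sum_card_fixed_frames F n j jn) natr_sum.
apply: eq_bigr => x xA; rewrite card_frames ?row_free_delta //; last first.
  move: xA; rewrite in_Aset => /andP[_ /eqP ex].
  by apply/sub_kermxP; rewrite mulmxBr mulmx1 ex subrr.
by apply: eq_bigr => l _; rewrite !natrX.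
Qed.

Lemma card_Aset_gt0 (F : finFieldType) (n : nat) : (0 < #|Aset F n|)%N.
Proof.
apply/card_gt0P; exists 1%:M.
by rewrite in_Aset unitmx1 trmx1 mulmx1 eqxx.
Qed.

Lemma natr_card_field_gt1 (F : finFieldType) (R : numDomainType) : 1 < (#|F|)%:R :> R.
Proof. by rewrite ltr1n card_finNzRing_gt1. Qed.

Lemma PA_exact (R : realType) (F : finFieldType) (n k : nat) :
  PA R F n k.+1 = (#|Aset F k|)%:R^-1 *
    \sum_(0 <= i < n.+1 - k)
      (-1) ^+ i / ((#|F|)%:R ^+ (k.+1 * i) *
                   \prod_(1 <= j < i.+1) ((#|F|)%:R ^+ j - 1)).
Proof.
set q : R := (#|F|)%:R; have q1 : 1 < q := natr_card_field_gt1 F R.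
have A0 m : (#|Aset F m|)%:R != 0 :> R by rewrite pnatr_eq0 -lt0n card_Aset_gt0.
apply: (canLR (mulfK (A0 n))); rewrite -mulrA; apply: (mulfI (A0 k)).
rewrite mulVKf //.
(* The order of A(k,q) is the constant on the right of the interpolation. In the [i]-th term the
   order of A(n,q) becomes the sum of falling products with [j = k + i], so that interpolation
   applies to each [x] separately. *)
rewrite (card_Aset F R k) mulr_suml.
under [RHS]eq_big_nat => i /andP[_ ik].
  rewrite -(mean_qfalling_fixdim F R n (k + i)); last by rewrite -leq_subRL; lia.
  rewrite mulr_sumr.
over.
rewrite exchange_big /=.
under [RHS]eq_bigr => x xA.
  rewrite qfalling_interpolation ?fixdim_bounds //.
over.
rewrite -mulr_suml mulrC; congr (_ * _); last first.
  by apply: eq_bigr => l _; rewrite !natrX.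
rewrite -natr_sum; congr (_%:R).
rewrite -sum1_card big_mkcond [RHS]big_mkcond /=; apply: eq_bigr => x _.
by rewrite inE; case: (x \in Aset F n) => //=; case: eqP.
Qed.

(** * The infinite series of (1): functional equation and limit in [k] *)

Local Open Scope classical_set_scope.
Local Open Scope ring_scope.

Definition qser (R : realType) (q : R) (k i : nat) : R :=
  (-1) ^+ i / (q ^+ (k * i) * \prod_(1 <= j < i.+1) (q ^+ j - 1)).

Lemma normr_qser (R : realType) (q : R) (k i : nat) : 2 <= q ->
  `|qser R q k i| <= (q ^- k) ^+ i.
Proof.
move=> q2; have q0 : 0 < q by lra.
have P1 : 1 <= \prod_(1 <= j < i.+1) (q ^+ j - 1).
  rewrite big_add1 big_mkord; elim/big_ind: _ => [//|x y|j _].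
    by move=> *; rewrite mulr_ege1.
  rewrite exprS; have : 1 <= q ^+ j by rewrite exprn_ege1 //; lra.
  by nra.
rewrite /qser normrM normrX normrN1 expr1n mul1r normfV normrM invfM.
rewrite exprVn -exprM ger0_norm ?exprn_ge0 ?(ltW q0) //.
rewrite ger_pMr ?invr_gt0 ?exprn_gt0 // ger0_norm ?(le_trans ler01) //.
by rewrite invf_le1 // (lt_le_trans ltr01).
Qed.

(** Raising [k] by one divides the term of index [i.+1] by [q ^+ i.+1]. Writing this power as
    [1 + (q ^+ i.+1 - 1)], the second summand cancels the last factor of the product. *)
Lemma qser_rec (R : realType) (q : R) (k i : nat) : 2 <= q ->
  qser R q k i.+1 = qser R q k.+1 i.+1 - q ^- k.+1 * qser R q k.+1 i.
Proof.
move=> q2; have q1 : 1 < q by lra.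
have q0 : q != 0 by rewrite gt_eqF // (lt_trans ltr01).
have P0 : \prod_(1 <= j < i.+1) (q ^+ j - 1) != 0.
  by rewrite prodf_seq_neq0; apply/allP => -[|j]; rewrite mem_index_iota // qpow_sub1_neq0.
rewrite /qser (big_nat_recr i.+1) //=.
have -> : q ^+ (k.+1 * i.+1) = q ^+ (k * i.+1) * q ^+ i.+1 by rewrite mulSn exprD mulrC.
have -> : q ^+ (k * i.+1) * q ^+ i.+1 = q ^+ k.+1 * q ^+ (k.+1 * i).
  by rewrite -!exprD; congr (_ ^+ _); lia.
have -> : q ^+ (k * i.+1) = q ^+ k.+1 * q ^+ (k.+1 * i) / q ^+ i.+1.
  by apply: (canRL (mulfK _)); rewrite ?expf_neq0 // -!exprD; congr (_ ^+ _); lia.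
have := qpow_sub1_neq0 R q i q1.
have := expf_neq0 i.+1 q0; have := expf_neq0 k.+1 q0; have := expf_neq0 (k.+1 * i) q0.
move: P0; set P := \prod_(_ <= _ < _) _ => P0.
rewrite (exprS (-1)); set a := q ^+ (_ * _); set b := q ^+ k.+1; set c := q ^+ i.+1.
by move=> a0 b0 c0 c1; field; rewrite a0 b0 c0 P0 c1.
Qed.

Lemma series_qser_rec (R : realType) (q : R) (k N : nat) : 2 <= q ->
  series (qser R q k) N.+1 =
  series (qser R q k.+1) N.+1 - q ^- k.+1 * series (qser R q k.+1) N.
Proof.
move=> q2; rewrite /series /=; elim: N => [|N IHN].
  by rewrite !big_nat1 big_geq // mulr0 subr0 /qser !muln0.
rewrite big_nat_recr //= IHN qser_rec // [in RHS]big_nat_recr //=.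
by rewrite [X in _ = _ - _ * X]big_nat_recr //=; ring.
Qed.

Lemma is_cvg_series_qser (R : realType) (q : R) (k : nat) : 2 <= q ->
  cvgn (series (qser R q k.+1)).
Proof.
move=> q2; have q0 : 0 < q by lra.
apply: normed_cvg; apply: (@series_le_cvg _ _ (geometric 1 (q ^- k.+1))) => /=.
- by move=> n; rewrite normr_ge0.
- by move=> n; rewrite mul1r exprn_ge0 // invr_ge0 exprn_ge0 // ltW.
- by move=> n; rewrite mul1r normr_qser.
apply: is_cvg_geometric_series; rewrite ger0_norm ?invr_ge0 ?exprn_ge0 ?(ltW q0) //.
by rewrite invf_lt1 ?exprn_gt0 // exprn_egt1 //; lra.
Qed.

Lemma limn_series_qser_rec (R : realType) (q : R) (k : nat) : 2 <= q ->
  limn (series (qser R q k.+1)) =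
  (1 - q ^- k.+2) * limn (series (qser R q k.+2)).
Proof.
move=> q2; set L := limn (series (qser R q k.+2)).
have cL : series (qser R q k.+2) @ \oo --> L := is_cvg_series_qser R q k.+1 q2.
apply/cvg_lim => //; rewrite -(cvg_shiftS (series _)) /=.
rewrite (eq_cvg _ _ (fun n => series_qser_rec R q k.+1 n q2)).
rewrite mulrBl mul1r; apply: cvgB; first by rewrite (cvg_shiftS (series _)).
exact: cvgMl_tmp.
Qed.

Lemma series_qser_near1 (R : realType) (q : R) (k N : nat) : 2 <= q ->
  `|series (qser R q k.+1) N.+1 - 1| <= 2 * q ^- k.+1.
Proof.
move=> q2; set y := q ^- k.+1; have q0 : 0 < q by lra.
have y0 : 0 <= y by rewrite invr_ge0 exprn_ge0 // ltW.
have y2 : 2 * y <= 1.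
  rewrite ler_pdivrMr ?exprn_gt0 // mul1r exprS.
  have : 1 <= q ^+ k by rewrite exprn_ege1 //; lra.
  by nra.
(* The subtracted term leaves room in the induction for the next summand, which is at most
   [y ^+ N.+1], because [2 * y <= 1]. *)
suff : `|series (qser R q k.+1) N.+1 - 1| <= 2 * y - 2 * y ^+ N.+1.
  by have := exprn_ge0 N.+1 y0; lra.
elim: N => [|N IHN].
  by rewrite /series /= big_nat1 /qser muln0 big_geq // mulr1 divr1 subrr normr0 expr1 subrr.
rewrite seriesSr addrAC (le_trans (ler_normD _ _)) //.
have := normr_qser R q k.+1 N.+1 q2; rewrite -/y [y ^+ N.+2]exprS.
have := exprn_ge0 N.+1 y0.
by move: IHN; move: (`|_|) (`|_|) (y ^+ _) => u v z; nra.
Qed.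

Lemma limn_series_qser_cvg1 (R : realType) (q : R) : 2 <= q ->
  (fun k => limn (series (qser R q k.+1))) @ \oo --> (1 : R).
Proof.
move=> q2; have q0 : 0 < q by lra.
have near1 k : `|limn (series (qser R q k.+1)) - 1| <= 2 * q ^- k.+1.
  have c : (fun N => `|series (qser R q k.+1) N.+1 - 1|) @ \oo -->
      `|limn (series (qser R q k.+1)) - 1|.
    apply: cvg_norm; apply: cvgB; last exact: cvg_cst.
    by rewrite (cvg_shiftS (series _)); exact: is_cvg_series_qser.
  rewrite -(cvg_lim _ c) //; apply: limr_le; first by apply/cvg_ex; eexists; exact: c.
  by near=> N; exact: series_qser_near1.
have g0 : geometric (2 / q) q^-1 @ \oo --> (0 : R).
  apply: cvg_geometric; rewrite ger0_norm ?invr_ge0 ?ltW //.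
  by rewrite invf_lt1 //; lra.
apply/subr_cvg0/norm_cvg0P.
apply: squeeze_cvgr (cvg_cst 0) g0; near=> k.
rewrite normr_ge0 /= (le_trans (near1 k)) // -mulrA -exprVn -exprS exprVn.
exact: lexx.
Unshelve. all: by end_near.
Qed.

(** * The q-Pochhammer products (1/q; 1/q)_N and their limit *)

Definition qpoch (R : realType) (q : R) (N : nat) : R :=
  \prod_(1 <= r < N.+1) (1 - q ^- r).

Lemma qpoch_factor (R : realType) (q : R) (r : nat) : 1 < q -> 0 < 1 - q ^- r.+1 < 1.
Proof.
move=> q1; have q0 : 0 < q by rewrite (lt_trans ltr01).
by rewrite subr_gt0 invf_lt1 ?exprn_gt0 // exprn_egt1 // gtrBl invr_gt0 exprn_gt0.
Qed.

Lemma qpoch_gt0 (R : realType) (q : R) (N : nat) : 1 < q -> 0 < qpoch R q N.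
Proof.
move=> q1; rewrite /qpoch big_add1 big_mkord prodr_gt0 // => i _.
by have /andP[] := qpoch_factor R q i q1.
Qed.

Lemma qpochS (R : realType) (q : R) (N : nat) :
  qpoch R q N.+1 = qpoch R q N * (1 - q ^- N.+1).
Proof. by rewrite /qpoch big_nat_recr. Qed.

Lemma is_cvg_qpoch (R : realType) (q : R) : 1 < q -> cvgn (qpoch R q).
Proof.
move=> q1; apply: nonincreasing_is_cvgn.
  apply/nonincreasing_seqP => n; rewrite qpochS ger_pMr ?qpoch_gt0 //.
  by have /andP[_ /ltW] := qpoch_factor R q n q1.
by exists 0 => _ [n _ <-]; exact/ltW/qpoch_gt0.
Qed.

(* Euler's identity: the functional equation makes [qpoch k * lim] independent of
   [k], and the second factor tends to 1. *)
Lemma limn_series_qser (R : realType) (q : R) (k : nat) : 2 <= q ->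
  qpoch R q k.+1 * limn (series (qser R q k.+1)) = limn (qpoch R q).
Proof.
move=> q2; have q1 : 1 < q by lra.
have inv M : qpoch R q (M + k).+1 * limn (series (qser R q (M + k).+1)) =
    qpoch R q k.+1 * limn (series (qser R q k.+1)).
  elim: M => [//|M <-]; rewrite addSn qpochS -mulrA; congr (_ * _).
  by rewrite [RHS]limn_series_qser_rec.
have c : (fun M => qpoch R q M.+1 * limn (series (qser R q M.+1))) @ \oo -->
    limn (qpoch R q).
  rewrite -[X in _ --> X]mulr1; apply: cvgM; last exact: limn_series_qser_cvg1.
  by rewrite (cvg_shiftS (qpoch R q)); exact: is_cvg_qpoch.
(* Shifted by [k], the convergent sequence is constant by [inv], so the constant is its limit. *)
rewrite -(cvg_shiftn k) (eq_cvg _ _ inv) in c.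
by rewrite -(cvg_lim (@Rhausdorff R) c) lim_cst.
Qed.

(** * The limiting law *)

Lemma card_Aset_qpoch (R : realType) (F : finFieldType) (k : nat) :
  #|Aset F k|%:R = (#|F|)%:R ^+ (k.+1 * k) * qpoch R (#|F|)%:R k.
Proof.
set q : R := (#|F|)%:R.
have q0 : q != 0 by rewrite gt_eqF // (lt_trans ltr01) ?natr_card_field_gt1.
(* With the index reversed, [q ^+ k.+1] comes out of each of the [k] factors. *)
rewrite card_Aset /qpoch big_add1 big_mkord (reindex_inj rev_ord_inj) /=.
rewrite exprM -[X in _ = _ ^+ X * _]card_ord -prodr_const -big_split /=.
apply: eq_bigr => i _; rewrite !natrX -/q mulrBr mulr1; congr (_ - _).
apply: (canRL (mulfK _)); rewrite ?expf_neq0 // -exprD; congr (_ ^+ _).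
by have := ltn_ord i; lia.
Qed.

Lemma PA_cvg (R : realType) (F : finFieldType) (k : nat) :
  (fun n : nat => PA R F n k.+1) @ \oo -->
    (#|Aset F k|)%:R^-1 * limn (series (qser R (#|F|)%:R k.+1)).
Proof.
have q2 : 2 <= (#|F|)%:R :> R by rewrite ler_nat card_finNzRing_gt1.
(* Shifting [n] by [k] removes the truncated subtraction and gives a plain partial sum. *)
have PAE n : PA R F (n + k) k.+1 =
    (#|Aset F k|)%:R^-1 * series (qser R (#|F|)%:R k.+1) n.+1.
  by rewrite PA_exact -addSn addnK.
rewrite -(cvg_shiftn k) (eq_cvg _ _ PAE).
by apply: cvgMl_tmp; rewrite (cvg_shiftS (series _)); exact: is_cvg_series_qser.
Qed.

(* q = #|F| ranges over all prime powers as F ranges over finite fields. *)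
Theorem theorem4p4 (R : realType) (F : finFieldType) (k : nat) (hk : (1 <= k)%N) :
  (forall n : nat,
    PA R F n k =
      (#|Aset F k.-1|)%:R^-1 *
      \sum_(0 <= i < (n.+2 - k)%N)
        ((-1) ^+ i / (((#|F| ^ (k * i))%N)%:R *
                      \prod_(1 <= j < i.+1) (((#|F| ^ j)%N)%:R - 1)))) /\
  (exists Pi : R,
    (fun N : nat => \prod_(1 <= r < N.+1) (1 - ((#|F|)%:R ^- r) : R)) @ \oo --> Pi /\
    (fun n : nat => PA R F n k) @ \oo -->
      Pi * (((#|F|)%:R^-1) ^+ (k ^ 2 - k) /
            ((\prod_(1 <= j < k) (1 - (#|F|)%:R ^- j) ^+ 2) * (1 - (#|F|)%:R ^- k)))).
Proof.
case: k hk => // k _; split => [n|].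
  rewrite PA_exact subSS; congr (_ * _); apply: eq_bigr => i _.
  by rewrite natrX; congr (_ / (_ * _)); apply: eq_bigr => j _; rewrite natrX.
have q2 : 2 <= (#|F|)%:R :> R by rewrite ler_nat card_finNzRing_gt1.
have q1 := natr_card_field_gt1 F R.
exists (limn (qpoch R (#|F|)%:R)); split; first exact: is_cvg_qpoch.
(* With the infinite product written as [qpoch] at [k.+1] times the series limit, that limit occurs
   on both sides and only the order of A(k,q) remains to be matched. *)
rewrite -(limn_series_qser R _ k q2).
rewrite [X in _ --> X](_ : _ = (#|Aset F k|)%:R^-1 * limn (series (qser R (#|F|)%:R k.+1))).
  exact: PA_cvg.
(* The squared product is the square of [qpoch] at [k]; one copy and the last factor cancel against
   [qpoch] at [k.+1]. *)
rewrite card_Aset_qpoch prodrXl -/(qpoch R _ k) qpochS exprVn.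
rewrite (_ : (k.+1 ^ 2 - k.+1)%N = (k.+1 * k)%N); last by rewrite -mulnn; lia.
have /gt_eqF/negbT c0 := qpoch_gt0 R _ k q1.
have /andP[/gt_eqF/negbT d0 _] := qpoch_factor R _ k q1.
have e0 : (#|F|)%:R ^+ (k.+1 * k) != 0 :> R by rewrite expf_neq0 // gt_eqF // (lt_trans ltr01).
move: c0 d0 e0; move: (qpoch _ _ _) (1 - _) (_ ^+ (k.+1 * k)) => c d e c0 d0 e0.
by field; rewrite c0 d0 e0.
Qed.
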